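(* Let $\mathbb{F}$ be a field and let $\mathfrak{A}$ be the ternary algebra on the space $M_n(\mathbb{F})$ of $n\times n$ matrices with product $$[A,B,C]=ABC+ACB+BAC+BCA+CAB+CBA .$$ Let $e_{ij}$ denote the matrix units. Given different $i,j\in\{1,\dots,n\}$, the $2$-dimensional subalgebras $$\mathfrak{S}_1=\langle e_{ii},e_{ij}\rangle_{\mathbb{F}}\quad\text{and}\quad \mathfrak{S}_2=\langle e_{ij},e_{ji}\rangle_{\mathbb{F}}$$ are non-isomorphic ternary Jordan subalgebras of $\mathfrak{A}$. Further, $\mathfrak{S}_2$ is simple.
   Context: A subalgebra of a ternary algebra is a subspace $\mathcal{S}$ with $[\mathcal{S},\mathcal{S},\mathcal{S}]\subseteq\mathcal{S}$. A ternary algebra with trilinear product $[\cdot,\cdot,\cdot]$ is a ternary Jordan algebra if (i) the product is totally commutative, i.e. $[x_{\sigma(1)},x_{\sigma(2)},x_{\sigma(3)}]=[x_1,x_2,x_3]$ for all permutations $\sigma\in S_3$; and (ii) for all pairs $x=(x_1,x_2)$, $y=(y_1,y_2)$ of elements, the linear map $D_{x,y}(z)=[[z,x_1,x_2],y_1,y_2]-[[z,y_1,y_2],x_1,x_2]$ is a derivation: $D_{x,y}[z_1,z_2,z_3]=[D_{x,y}(z_1),z_2,z_3]+[z_1,D_{x,y}(z_2),z_3]+[z_1,z_2,D_{x,y}(z_3)]$ for all $z_1,z_2,z_3$. An ideal of a ternary algebra $\mathcal{A}$ is a subspace $\mathcal{I}$ with $[\mathcal{I},\mathcal{A},\mathcal{A}],[\mathcal{A},\mathcal{I},\mathcal{A}],[\mathcal{A},\mathcal{A},\mathcal{I}]\subseteq\mathcal{I}$;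 $\mathcal{A}$ is simple if $[\mathcal{A},\mathcal{A},\mathcal{A}]\neq 0$ and its only ideals are $0$ and $\mathcal{A}$.
   Formalization: Non-isomorphism and simplicity of S_2 are claimed only when char F ≠ 2; in characteristic 2 both subalgebras have zero product, so they are isomorphic and S_2 is not simple. The remaining claims hold for every field. *)

(* Defs.v *)
From HB Require Import structures.
From mathcomp Require Import all_boot all_order all_fingroup all_algebra.
Set Implicit Arguments.
Unset Strict Implicit.
Unset Printing Implicit Defensive.
Import GRing.Theory.
Local Open Scope ring_scope.

Record ternaryAlg (F : fieldType) := TernaryAlg {
  tsort :> vectType F;
  tmul : tsort -> tsort -> tsort -> tsort;
  tmul_linear1 : forall y z, linear (fun x => tmul x y z);
  tmul_linear2 : forall x z, linear (fun y => tmul x y z);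
  tmul_linear3 : forall x y, linear (fun z => tmul x y z) }.

Section TernaryAlgebra.
Variables (F : fieldType) (A : ternaryAlg F).

Definition subalgebra (S : {vspace A}) : Prop :=
  forall x y z, x \in S -> y \in S -> z \in S -> tmul x y z \in S.

Definition ideal (I : {vspace A}) : Prop :=
  forall x y z, x \in I ->
  [/\ tmul x y z \in I, tmul y x z \in I & tmul y z x \in I].

Definition simple_talg : Prop :=
  (exists x y z : A, tmul x y z != 0) /\
  (forall I : {vspace A}, ideal I -> I = 0%VS \/ I = fullv).

(* 0, 1, 2 : 'I_3 are read in the ring Z/3, i.e. they are the three indices. *)
Definition totally_commutative : Prop :=
  forall (s : 'S_3) (x : 'I_3 -> A),
    tmul (x (s 0)) (x (s 1)) (x (s 2)) = tmul (x 0) (x 1) (x 2).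

(* Linearity is not repeated here: the only maps considered, [Dmap x y] below,
   are linear because the product is trilinear. *)
Definition derivation (D : A -> A) : Prop :=
  forall z1 z2 z3, D (tmul z1 z2 z3) =
    tmul (D z1) z2 z3 + tmul z1 (D z2) z3 + tmul z1 z2 (D z3).

Definition Dmap (x y : A * A) (z : A) : A :=
  tmul (tmul z x.1 x.2) y.1 y.2 - tmul (tmul z y.1 y.2) x.1 x.2.

Definition ternary_jordan : Prop :=
  totally_commutative /\ (forall x y : A * A, derivation (Dmap x y)).

End TernaryAlgebra.

Definition isomorphic_talg (F : fieldType) (A B : ternaryAlg F) : Prop :=
  exists f : {linear A -> B}, bijective f /\
    (forall x y z : A, f (tmul x y z) = tmul (f x) (f y) (f z)).

Section Subalgebra.
Variables (F : fieldType) (A : ternaryAlg F) (S : {vspace A}).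
Hypothesis closedS : subalgebra S.

Definition sub_tmul (x y z : subvs_of S) : subvs_of S :=
  Subvs (closedS (subvsP x) (subvsP y) (subvsP z)).

Lemma sub_tmul_linear1 y z : linear (fun x => sub_tmul x y z).
Proof. by move=> a u v; apply: val_inj; rewrite /= tmul_linear1. Qed.

Lemma sub_tmul_linear2 x z : linear (fun y => sub_tmul x y z).
Proof. by move=> a u v; apply: val_inj; rewrite /= tmul_linear2. Qed.

Lemma sub_tmul_linear3 x y : linear (fun z => sub_tmul x y z).
Proof. by move=> a u v; apply: val_inj; rewrite /= tmul_linear3. Qed.

Definition sub_talg : ternaryAlg F :=
  TernaryAlg sub_tmul_linear1 sub_tmul_linear2 sub_tmul_linear3.

End Subalgebra.

Section MatrixTernaryAlgebra.
Variables (F : fieldType) (n : nat).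

Definition mx_tmul (A B C : 'M[F]_n) : 'M[F]_n :=
  A *m B *m C + A *m C *m B + B *m A *m C
  + B *m C *m A + C *m A *m B + C *m B *m A.

Lemma linear_sum2 (U V : lmodType F) (f g : U -> V) :
  linear f -> linear g -> linear (fun x => f x + g x).
Proof. by move=> hf hg a u v; rewrite hf hg scalerDr addrACA. Qed.

Lemma mx_tmul_linear1 B C : linear (fun A => mx_tmul A B C).
Proof.
by do 5?[apply: linear_sum2] => a U V;
  rewrite !(mulmxDl, mulmxDr) -!(scalemxAl, scalemxAr).
Qed.

Lemma mx_tmul_linear2 A C : linear (fun B => mx_tmul A B C).
Proof.
by do 5?[apply: linear_sum2] => a U V;
  rewrite !(mulmxDl, mulmxDr) -!(scalemxAl, scalemxAr) ?(mulmxDl, mulmxDr)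
    -?(scalemxAl, scalemxAr).
Qed.

Lemma mx_tmul_linear3 A B : linear (fun C => mx_tmul A B C).
Proof.
by do 5?[apply: linear_sum2] => a U V;
  rewrite !(mulmxDl, mulmxDr) -!(scalemxAl, scalemxAr).
Qed.

Definition mx_talg : ternaryAlg F :=
  TernaryAlg mx_tmul_linear1 mx_tmul_linear2 mx_tmul_linear3.

Definition S1 (i j : 'I_n) : {vspace mx_talg} :=
  <<[:: delta_mx i i : mx_talg; delta_mx i j : mx_talg]>>%VS.

Definition S2 (i j : 'I_n) : {vspace mx_talg} :=
  <<[:: delta_mx i j : mx_talg; delta_mx j i : mx_talg]>>%VS.

End MatrixTernaryAlgebra.

(* Main.v *)
Require Import Defs.
From mathcomp Require Import all_boot all_order all_fingroup all_algebra.
From mathcomp Require Import ring.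
Import GRing.Theory.
Local Open Scope ring_scope.

(** The subspaces S1 and S2 are planes, so both products are explicit binary
    cubic forms.  Write a, b for the two listed matrix units.  In S1 (a = e_ii,
    b = e_ij) one has aa = a, ab = b, ba = bb = 0, whence

      [a,a,a] = 6a,  [a,a,b] = 2b,  [a,b,b] = [b,b,b] = 0,

    and in S2 (a = e_ij, b = e_ji) one has aba = a, bab = b, aa = bb = 0, whence

      [a,a,a] = 0,  [a,a,b] = 2a,  [a,b,b] = 2b,  [b,b,b] = 0.

    The product on all matrices is totally commutative, so these tables give the
    product of any three elements in coordinates ([tmul_comb], [S1_mul],
    [S2_mul]).  The tables show that both planes are closed.  In these
    coordinates D_{x,y} is a multiple of the map a |-> b, b |-> 0 on S1, and of
    the grading a |-> a, b |-> -b on S2.  Both of these are derivations, which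
    amounts to a polynomial identity in the coordinates.

    Let 2 be invertible.  If x = p a + q b lies in an ideal of S2, then so do
    [x,a,a] = 2q a and [x,b,b] = 2p b.  A nonzero x therefore produces a or b,
    and [a,b,b] = 2b, [b,a,a] = 2a produce the other one: S2 is simple
    ([S2_simple]).  In S1 the line spanned by b is an ideal, and an isomorphism
    would carry it to a proper nonzero ideal of S2, so S1 and S2 are not
    isomorphic. *)

(** * Totally commutative ternary algebras *)

(** The transpositions (0 1) and (1 2) generate S_3. *)
Lemma totally_commutative_swaps (F : fieldType) (A : ternaryAlg F) :
  (forall x y z : A, tmul x y z = tmul y x z) ->
  (forall x y z : A, tmul x y z = tmul x z y) ->
  totally_commutative A.
Proof.
move=> C12 C23 s x.
have D01 : s 0 != s 1 by rewrite (inj_eq perm_inj).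
have D02 : s 0 != s 2 by rewrite (inj_eq perm_inj).
have D12 : s 1 != s 2 by rewrite (inj_eq perm_inj).
have I3 (k : 'I_3) : [\/ k = 0, k = 1 | k = 2].
  by case: k => [[|[|[|//]]] k3]; [apply: Or31|apply: Or32|apply: Or33];
     apply: val_inj.
move: D01 D02 D12; case: (I3 (s 0)) => ->; case: (I3 (s 1)) => -> //=;
  case: (I3 (s 2)) => -> //= _ _ _.
- by rewrite C23 C12.
- by rewrite C12 C23.
- by rewrite C12 C23 C12.
Qed.

Section TotallyCommutative.
Variables (F : fieldType) (A : ternaryAlg F).
Implicit Types (a b x y z : A) (p q r : F * F).

Lemma tmul0l y z : tmul 0 y z = 0.
Proof. by have := tmul_linear1 y z (-1) 0 0; rewrite scaler0 addr0 scaleN1r addNr. Qed.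

Lemma tmulZl c x y z : tmul (c *: x) y z = c *: tmul x y z.
Proof. by rewrite -[c *: x]addr0 (tmul_linear1 y z c x 0) tmul0l addr0. Qed.

Hypothesis C12 : forall x y z, tmul x y z = tmul y x z.
Hypothesis C23 : forall x y z, tmul x y z = tmul x z y.

Definition comb a b p : A := p.1 *: a + p.2 *: b.

(** Polarization: total commutativity leaves only four products of the two
    basis elements to be known. *)
Lemma tmul_comb a b p q r :
  tmul (comb a b p) (comb a b q) (comb a b r) =
    (p.1 * q.1 * r.1) *: tmul a a a
    + (p.1 * q.1 * r.2 + p.1 * q.2 * r.1 + p.2 * q.1 * r.1) *: tmul a a b
    + (p.1 * q.2 * r.2 + p.2 * q.1 * r.2 + p.2 * q.2 * r.1) *: tmul a b b
    + (p.2 * q.2 * r.2) *: tmul b b b.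
Proof.
have L1 c x d y z t : tmul (c *: x + d *: y) z t = c *: tmul x z t + d *: tmul y z t.
  by rewrite (tmul_linear1 z t c x) tmulZl.
have L2 c x d y z t : tmul z (c *: x + d *: y) t = c *: tmul z x t + d *: tmul z y t.
  by rewrite C12 L1 ![tmul _ z t]C12.
have L3 c x d y z t : tmul z t (c *: x + d *: y) = c *: tmul z t x + d *: tmul z t y.
  by rewrite C23 L2 ![tmul z _ t]C23.
rewrite /comb L1 !L2 !L3 (C23 a b a) (C12 b a a) (C23 a b a) (C12 b a b).
rewrite (C23 b b a) (C12 b a b).
rewrite !scalerDr !scalerDl !scalerA !addrA.
(* Of the eight words in a and b, taken in lexicographic order, baa has to
   move before abb; the four classes are then contiguous. *)
by rewrite [LHS](AC 8 (1*2*3*5*4*6*7*8)) /=.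
Qed.

Lemma span2P a b x : reflect (exists p, x = comb a b p) (x \in <<[:: a; b]>>%VS).
Proof.
rewrite span_cons span_seq1; apply: (iffP memv_addP) => [[_ /vlineP[c ->]]|[p ->]].
  by case=> _ /vlineP[d ->] ->; exists (c, d).
exists (p.1 *: a); first exact/memvZ/memv_line.
by exists (p.2 *: b); first exact/memvZ/memv_line.
Qed.

(** A subalgebra carries the restricted product, so its Jordan identity is that
    of the ambient algebra with all arguments taken in S; this frees the
    computations from the subspace type. *)
Lemma sub_jordan (S : {vspace A}) (h : subalgebra S) :
  (forall x1 x2 y1 y2 z1 z2 z3,
    x1 \in S -> x2 \in S -> y1 \in S -> y2 \in S ->
    z1 \in S -> z2 \in S -> z3 \in S ->
    let D := Dmap (x1, x2) (y1, y2) in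
    D (tmul z1 z2 z3) =
      tmul (D z1) z2 z3 + tmul z1 (D z2) z3 + tmul z1 z2 (D z3)) ->
  ternary_jordan (sub_talg h).
Proof.
move=> derS; split.
  by apply: totally_commutative_swaps => x y z; apply: val_inj; [apply: C12|apply: C23].
move=> [x1 x2] [y1 y2] z1 z2 z3; apply: val_inj.
by have := derS _ _ _ _ _ _ _ (subvsP x1) (subvsP x2) (subvsP y1) (subvsP y2)
  (subvsP z1) (subvsP z2) (subvsP z3).
Qed.

End TotallyCommutative.

Arguments comb {F A} a b p.

(** If x were nonzero, its line would be an ideal (one argument suffices, by
    total commutativity) of dimension 1, hence neither 0 nor the whole plane.
    This separates S1 from S2 without transporting ideals along isomorphisms. *)
Lemma simple_plane_no_stable_line (F : fieldType) (B : ternaryAlg F) (x : B) :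
  totally_commutative B -> simple_talg B -> \dim {:B} = 2%N ->
  (forall y z, tmul x y z \in <[x]>%VS) -> x = 0.
Proof.
move=> CB [_ simB] dimB stab.
have C12 (u v w : B) : tmul u v w = tmul v u w.
  have := CB (tperm 0 1) (fun k => if k == 0 then v else if k == 1 then u else w).
  by rewrite tpermL tpermR tpermD.
have C23 (u v w : B) : tmul u v w = tmul u w v.
  have := CB (tperm 1 2) (fun k => if k == 0 then u else if k == 1 then w else v).
  by rewrite tpermL tpermR tpermD.
have line_ideal : ideal <[x]>%VS.
  move=> _ y z /vlineP[c ->].
  have xyz : tmul (c *: x) y z \in <[x]>%VS by rewrite tmulZl memvZ ?stab.
  by split=> //; [rewrite C12 | rewrite C23 C12].
case: (simB _ line_ideal) => [x0|xT].
  by apply/eqP; rewrite -memv0 -x0 memv_line.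
by move: dimB; rewrite -xT dim_vline; case: (x != 0).
Qed.

(** * The two planes of matrices *)

Section Planes.
Variables (F : fieldType) (n : nat) (i j : 'I_n).
Hypothesis neq_ij : i != j.
Notation M := (mx_talg F n).
Implicit Types (x y z : M) (p q r : F * F).

Lemma mx_tmulC12 x y z : tmul x y z = tmul y x z.
Proof. by rewrite /= /mx_tmul [LHS](ACl (3*4*1*2*6*5)). Qed.

Lemma mx_tmulC23 x y z : tmul x y z = tmul x z y.
Proof. by rewrite /= /mx_tmul [LHS](ACl (2*1*5*6*3*4)). Qed.

Let eij : M := delta_mx i j.
Let eji : M := delta_mx j i.
Let eii : M := delta_mx i i.

Let neq_ijF : (i == j) = false. Proof. exact: negbTE. Qed.
Let neq_jiF : (j == i) = false. Proof. by rewrite eq_sym. Qed.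

Definition S1_coord_mul p q r : F * F :=
  (6%:R * (p.1 * q.1 * r.1),
   2%:R * (p.1 * q.1 * r.2 + p.1 * q.2 * r.1 + p.2 * q.1 * r.1)).

Definition S2_coord_mul p q r : F * F :=
  (2%:R * (p.1 * q.1 * r.2 + p.1 * q.2 * r.1 + p.2 * q.1 * r.1),
   2%:R * (p.1 * q.2 * r.2 + p.2 * q.1 * r.2 + p.2 * q.2 * r.1)).

Ltac mx_table := rewrite /= /mx_tmul ?mul_delta_mx_cond ?mulmx0 ?mul0mx
  ?(eqxx, neq_ijF, neq_jiF, mulr1n, mulr0n, mulmx0, mul0mx, mul_delta_mx_cond,
    addr0, add0r).

Lemma S1_mul p q r :
  tmul (comb eii eij p) (comb eii eij q) (comb eii eij r) = comb eii eij (S1_coord_mul p q r).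
Proof.
have aaa : tmul eii eii eii = 6%:R *: eii.
  by mx_table; rewrite scaler_nat !mulrSr mulr0n add0r.
have aab : tmul eii eii eij = 2%:R *: eij.
  by mx_table; rewrite scaler_nat !mulrSr mulr0n add0r.
have abb : tmul eii eij eij = 0 by mx_table.
have bbb : tmul eij eij eij = 0 by mx_table.
rewrite (tmul_comb _ _ mx_tmulC12 mx_tmulC23) aaa aab abb bbb.
by rewrite !scaler0 !addr0 !scalerA /comb /= ![_%:R * _]mulrC.
Qed.

Lemma S2_mul p q r :
  tmul (comb eij eji p) (comb eij eji q) (comb eij eji r) = comb eij eji (S2_coord_mul p q r).
Proof.
have aaa : tmul eij eij eij = 0 by mx_table.
have aab : tmul eij eij eji = 2%:R *: eij.
  by mx_table; rewrite scaler_nat !mulrSr mulr0n add0r.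
have abb : tmul eij eji eji = 2%:R *: eji.
  by mx_table; rewrite scaler_nat !mulrSr mulr0n add0r.
have bbb : tmul eji eji eji = 0 by mx_table.
rewrite (tmul_comb _ _ mx_tmulC12 mx_tmulC23) aaa aab abb bbb.
by rewrite !scaler0 !addr0 add0r !scalerA /comb /= ![_%:R * _]mulrC.
Qed.

Lemma S1_closed : subalgebra (S1 F i j).
Proof.
move=> x y z /span2P[p ->] /span2P[q ->] /span2P[r ->].
by apply/span2P; exists (S1_coord_mul p q r); apply: S1_mul.
Qed.

Lemma S2_closed : subalgebra (S2 F i j).
Proof.
move=> x y z /span2P[p ->] /span2P[q ->] /span2P[r ->].
by apply/span2P; exists (S2_coord_mul p q r); apply: S2_mul.
Qed.

(** The Jordan identity is stated on F * F, where each component is a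
    polynomial identity that [ring] decides. It descends to
    the plane because [comb a b] is additive. *)
Lemma plane_jordan (a b : M) (m : F * F -> F * F -> F * F -> F * F)
    (h : subalgebra <<[:: a; b]>>%VS) :
  (forall p q r, tmul (comb a b p) (comb a b q) (comb a b r) = comb a b (m p q r)) ->
  (forall p1 p2 q1 q2 r1 r2 r3,
    let D r := m (m r p1 p2) q1 q2 - m (m r q1 q2) p1 p2 in
    D (m r1 r2 r3) = m (D r1) r2 r3 + m r1 (D r2) r3 + m r1 r2 (D r3)) ->
  ternary_jordan (sub_talg h).
Proof.
move=> mE derm; apply: (sub_jordan _ _ mx_tmulC12 mx_tmulC23).
move=> _ _ _ _ _ _ _ /span2P[p1 ->] /span2P[p2 ->] /span2P[q1 ->] /span2P[q2 ->]
  /span2P[r1 ->] /span2P[r2 ->] /span2P[r3 ->] D.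
have combD p q : comb a b p + comb a b q = comb a b (p + q).
  by rewrite /comb /= !scalerDl addrACA.
have combB p q : comb a b p - comb a b q = comb a b (p - q).
  by rewrite /comb /= !scalerBl opprD addrACA.
have DE r : D (comb a b r)
    = comb a b (m (m r p1 p2) q1 q2 - m (m r q1 q2) p1 p2).
  by rewrite /D /Dmap [(_, _).1]/fst [(_, _).2]/snd !mE combB.
by rewrite !mE !DE !mE !combD derm.
Qed.

Lemma S1_jordan : ternary_jordan (sub_talg S1_closed).
Proof.
apply: (plane_jordan _ _ S1_coord_mul) => [p q r|p1 p2 q1 q2 r1 r2 r3 /=]; first exact: S1_mul.
by congr pair => /=; ring.
Qed.

Lemma S2_jordan : ternary_jordan (sub_talg S2_closed).
Proof.
apply: (plane_jordan _ _ S2_coord_mul) => [p q r|p1 p2 q1 q2 r1 r2 r3 /=]; first exact: S2_mul.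
by congr pair => /=; ring.
Qed.

Lemma S1_dim : \dim (S1 F i j) = 2%N.
Proof.
apply/eqP; rewrite -[_ == _]/(free [:: eii; eij]) free_cons span_seq1 seq1_free.
apply/andP; split.
  apply/vlineP => -[c /matrixP/(_ i i)/eqP].
  by rewrite !mxE !eqxx neq_ijF mulr0 oner_eq0.
by apply/eqP => /matrixP/(_ i j)/eqP; rewrite !mxE !eqxx oner_eq0.
Qed.

Lemma S2_dim : \dim (S2 F i j) = 2%N.
Proof.
apply/eqP; rewrite -[_ == _]/(free [:: eij; eji]) free_cons span_seq1 seq1_free.
apply/andP; split.
  apply/vlineP => -[c /matrixP/(_ i j)/eqP].
  by rewrite !mxE !eqxx neq_ijF mulr0 oner_eq0.
by apply/eqP => /matrixP/(_ j i)/eqP; rewrite !mxE !eqxx oner_eq0.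
Qed.

(** * Simplicity and non-isomorphism *)

Hypothesis two_neq0 : 2%:R != 0 :> F.

Lemma S2_simple : simple_talg (sub_talg S2_closed).
Proof.
set B := sub_talg S2_closed.
have comb_in p : comb eij eji p \in S2 F i j by apply/span2P; exists p.
pose e p : B := Subvs (comb_in p).
have e_mul p q r : tmul (e p) (e q) (e r) = e (S2_coord_mul p q r).
  by apply: val_inj; apply: S2_mul.
have e_onto (x : B) : exists p, x = e p.
  by have /span2P[p xE] := subvsP x; exists p; apply: val_inj.
have e_scale c p : e (c * p.1, c * p.2) = c *: e p.
  by apply: val_inj; rewrite /= /comb /= scalerDr !scalerA.
have eD p q : e (p + q) = e p + e q.
  by apply: val_inj; rewrite /= /comb /= !scalerDl addrACA.
have e_neq0 : e (1, 0) != 0.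
  apply/eqP => /(congr1 val)/matrixP/(_ i j)/eqP.
  by rewrite /= /comb /= !mxE !eqxx neq_ijF mulr0 addr0 mulr1 oner_eq0.
have scale_in (I : {vspace B}) c p q :
    c != 0 -> q = (c * p.1, c * p.2) -> e q \in I -> e p \in I.
  by move=> c0 ->; rewrite e_scale rpredZeq (negbTE c0).
split.
  exists (e (1, 0)), (e (1, 0)), (e (0, 1)); rewrite e_mul.
  have -> : S2_coord_mul (1, 0) (1, 0) (0, 1) = (2%:R * 1, 2%:R * 0) :> F * F.
    by congr pair => /=; ring.
  by rewrite (e_scale 2%:R (1, 0)) scaler_eq0 negb_or two_neq0.
move=> I idI.
(* [a,b,b] = 2b and [b,a,a] = 2a exchange the two basis vectors inside an ideal. *)
have ab : e (1, 0) \in I -> e (0, 1) \in I.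
  move=> aI; have [+ _ _] := idI _ (e (0, 1)) (e (0, 1)) aI; rewrite e_mul.
  by apply: (scale_in I 2%:R) => //; congr pair => /=; ring.
have ba : e (0, 1) \in I -> e (1, 0) \in I.
  move=> bI; have [+ _ _] := idI _ (e (1, 0)) (e (1, 0)) bI; rewrite e_mul.
  by apply: (scale_in I 2%:R) => //; congr pair => /=; ring.
case: (eqVneq I 0%VS) => [|I0]; [by left | right].
have aI : e (1, 0) \in I.
  have [[c d] xE] := e_onto (vpick I).
  have := memv_pick I; have := I0; rewrite -vpick0 xE => cd0 xI.
  case: (eqVneq d 0) => [d0|d0]; last first.
    have [+ _ _] := idI _ (e (1, 0)) (e (1, 0)) xI; rewrite e_mul.
    apply: (scale_in I (2%:R * d)); first by rewrite mulf_neq0.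
    by congr pair => /=; ring.
  apply: ba; have [+ _ _] := idI _ (e (0, 1)) (e (0, 1)) xI; rewrite e_mul.
  apply: (scale_in I (2%:R * c)); last by congr pair => /=; rewrite ?d0; ring.
  rewrite mulf_neq0 //; apply: contraNneq cd0 => c0; apply/eqP/val_inj.
  by rewrite /= /comb /= c0 d0 !scale0r addr0.
apply/vspaceP => x; rewrite memvf; have [[c d] ->] := e_onto x.
have -> : (c, d) = (c * 1, c * 0) + (d * 0, d * 1) by congr pair => /=; ring.
by rewrite eD (e_scale c (1, 0)) (e_scale d (0, 1)) memvD ?memvZ ?ab ?aI.
Qed.

Lemma S1_not_iso_S2 : ~ isomorphic_talg (sub_talg S1_closed) (sub_talg S2_closed).
Proof.
case=> f [[g fK gK] fM].
have bS : eij \in S1 F i j by apply/span2P; exists (0, 1); rewrite /comb scale0r add0r scale1r.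
pose b : sub_talg S1_closed := Subvs bS.
have b_line (y z : sub_talg S1_closed) : tmul b y z \in <[b]>%VS.
  have /span2P[q yE] := subvsP y; have /span2P[r zE] := subvsP z.
  apply/vlineP; exists (2%:R * (q.1 * r.1)); apply: val_inj.
  have bE : eij = comb eii eij (0, 1) by rewrite /comb scale0r add0r scale1r.
  rewrite [LHS]/= yE zE {1}bE [LHS]S1_mul /comb /=.
  by rewrite !(mul0r, mulr0, scale0r, add0r, mul1r).
have fb0 : f b = 0.
  apply: simple_plane_no_stable_line S2_simple _ _.
  - by case: S2_jordan.
  - by rewrite dimvf; apply: S2_dim.
  move=> y z; rewrite -(gK y) -(gK z) -fM.
  by have /vlineP[c ->] := b_line (g y) (g z); rewrite linearZ memvZ ?memv_line.
have /(congr1 val)/matrixP/(_ i j)/eqP : b = 0.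
  by apply: (can_inj fK); rewrite fb0 linear0.
by rewrite !mxE !eqxx oner_eq0.
Qed.

End Planes.

Theorem theorem13 (F : fieldType) (n : nat) (i j : 'I_n) :
  i != j ->
  exists (h1 : subalgebra (S1 F i j)) (h2 : subalgebra (S2 F i j)),
    [/\ \dim (S1 F i j) = 2%N,
        \dim (S2 F i j) = 2%N,
        ternary_jordan (sub_talg h1)
      & ternary_jordan (sub_talg h2)] /\
    (2%N \notin [pchar F] ->
      ~ isomorphic_talg (sub_talg h1) (sub_talg h2) /\
      simple_talg (sub_talg h2)).
Proof.
move=> neq_ij; exists (S1_closed F n i j neq_ij), (S2_closed F n i j neq_ij).
split; first by split; [apply: S1_dim|apply: S2_dim|apply: S1_jordan|apply: S2_jordan].
rewrite inE /= => two_neq0.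
by split; [apply: S1_not_iso_S2 | apply: S2_simple].
Qed.
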